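(* Let $X,Y$ be two median spaces and $1 \in X$ a basepoint. Then the diadem product $((X,1) \circledast Y, \delta)$ is a median space.
   Context: In a metric space $X$, the interval between $x,y$ is $I(x,y) = \{ z \in X \mid d(x,y)=d(x,z)+d(z,y)\}$, and $X$ is median if, for all $x,y,z\in X$, the intersection $I(x,y) \cap I(y,z) \cap I(x,z)$ is a single point. Let $Y$ be a median space. A subspace $C \subset Y$ is convex if $I(x,y)\subset C$ for all $x,y \in C$; the convex hull of a subset is the smallest convex subspace containing it. A halfspace is a convex subspace whose complement is convex, and a hyperplane is a pair $\{D,D^c\}$ where $D$ and $D^c$ are non-empty halfspaces. A hyperplane $\{D,D^c\}$ separates two points if one lies in $D$ and the other in $D^c$; $\mathcal{W}(x\mid y)$ denotes the set of hyperplanes separating $x$ and $y$. It is known (Chatterji-Drutu-Haglund) that the set of hyperplanes of $Y$ carries a $\sigma$-algebra and a measure $\mu$ such that each $\mathcal{W}(x \mid y)$ is measurable with $\mu(\mathcal{W}(x\mid y))=d(x,y)$; fix such a measure. For $F \subset Y$, $\mathcal{H}(F)$ is the set of hyperplanes separating two points of $F$; when the convex hull of $F$ is the convex hull of finitely many points, $\mathcal{H}(F)$ is measurable of finite measure and one writes $\mu(F) := \mu(\mathcal{H}(F))$. $\mathcal{F}(Y)$ denotes the set of non-empty finitely generated convex subspaces of $Y$, i.e. convex hulls of finitely many (at least one) points. Diadem product: given median spaces $X,Y$ and a basepoint $1 \in X$, let $X^{(Y)}$ be the set of maps $\varphi : Y \to X$ with $\varphi(y)=1$ for all but finitely many $y$.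 The diadem product $(X,1) \circledast Y$ is the set of pairs (wreaths) $(C,\varphi)$ with $C \in \mathcal{F}(Y)$ and $\varphi \in X^{(Y)}$, endowed with $$\delta((C_1,\varphi_1),(C_2,\varphi_2)) = 2 \mu(C_1 \cup C_2 \cup \varphi_1 \Delta \varphi_2)- \mu(C_1)- \mu(C_2)+ \sum_{y \in Y} d(\varphi_1(y), \varphi_2(y)),$$ where $\varphi_1 \Delta \varphi_2 = \{ y \in Y \mid \varphi_1(y) \neq \varphi_2(y)\}$. *)

(* Defs.v *)
From HB Require Import structures.
From mathcomp Require Import all_boot all_order all_algebra.
From mathcomp Require Import all_classical all_reals all_analysis.

Set Implicit Arguments.
Unset Strict Implicit.
Unset Printing Implicit Defensive.

Import Order.TTheory GRing.Theory Num.Theory.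

Local Open Scope classical_set_scope.
Local Open Scope ring_scope.

Section Distances.
Context {R : realType} {T : Type}.
Implicit Type d : T -> T -> R.

(* The axioms of the factory isMetric, as a predicate on a bare function. *)
Definition is_metric d : Prop :=
  [/\ forall x, d x x = 0,
      forall x y, d x y = 0 -> x = y,
      forall x y, d x y = d y x
    & forall y x z, d x z <= d x y + d y z].

Definition ival d (x y : T) : set T := [set z | d x y = d x z + d z y].

Definition is_median d : Prop :=
  forall x y z, exists m, ival d x y `&` ival d y z `&` ival d x z = [set m].

Definition median_space d : Prop := is_metric d /\ is_median d.

End Distances.

Section Hyperplanes.
Context {R : realType} {Y : metricType R}.

Definition mconvex (C : set Y) : Prop :=
  forall x y, C x -> C y -> ival (@mdist R Y) x y `<=` C.

Definition mhull (S : set Y) : set Y := smallest mconvex S.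

Definition fg_convex (C : set Y) : Prop :=
  exists S : set Y, [/\ finite_set S, S !=set0 & C = mhull S].

Definition halfspace (D : set Y) : Prop := mconvex D /\ mconvex (~` D).

(* A hyperplane is the unordered pair {D, D^c}, i.e. an element of
   [set (set Y)]. *)
Definition hyperplanes : set (set (set Y)) :=
  [set h | exists D : set Y,
    [/\ halfspace D, D !=set0, ~` D !=set0 & h = [set D; ~` D]]].

(* As [h] is of the form {D, D^c}, the relation is symmetric in x and y. *)
Definition separates (h : set (set Y)) (x y : Y) : Prop :=
  exists D : set Y, [/\ h D, D x & (~` D) y].

Definition walls (x y : Y) : set (set (set Y)) :=
  [set h | hyperplanes h /\ separates h x y].

Definition walls_of (F : set Y) : set (set (set Y)) :=
  [set h | hyperplanes h /\ exists x y, [/\ F x, F y & separates h x y]].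

(* [G] is a sigma-algebra on the set of hyperplanes.  As measurable types are
   pointed and Y may have no hyperplane, a measure on G is represented by a
   measure on the sigma-algebra of [set (set Y)] generated by G; this amounts
   to the same, since every measure on G extends (by A |-> mu (A `&` hyperplanes))
   and only its values on G are used. *)
Definition hyperplane_measure (G : set (set (set (set Y))))
    (mu : {measure set (g_sigma_algebraType G) -> \bar R}) : Prop :=
  [/\ forall A, G A -> A `<=` hyperplanes,
      sigma_algebra hyperplanes G,
      forall x y : Y, G (walls x y)
    & forall x y : Y, mu (walls x y) = (mdist x y)%:E].

(* [fine] is harmless on the sets F whose hull is finitely generated, for which
   [walls_of F] has finite measure. *)
Definition wall_measure (mu : set (set (set Y)) -> \bar R) (F : set Y) : R :=
  fine (mu (walls_of F)).

End Hyperplanes.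

Section Diadem.
Context {R : realType} {X Y : metricType R}.

Record diadem (x0 : X) : Type := Wreath {
  wreath_set : set Y;
  wreath_map : Y -> X;
  wreath_setP : fg_convex wreath_set;
  wreath_mapP : finite_set [set y | wreath_map y <> x0]
}.

Definition map_diff (f g : Y -> X) : set Y := [set y | f y <> g y].

Definition diadem_dist (mu : set (set (set Y)) -> \bar R) (x0 : X)
    (w1 w2 : diadem x0) : R :=
  let: Wreath C1 f1 _ _ := w1 in
  let: Wreath C2 f2 _ _ := w2 in
  2 * wall_measure mu (C1 `|` C2 `|` map_diff f1 f2)
  - wall_measure mu C1 - wall_measure mu C2
  + \sum_(y \in [set: Y]) mdist (f1 y) (f2 y).

End Diadem.

Arguments diadem {R} X Y x0.

(* Main.v *)
(* Write [F_ij = C_i U C_j U (phi_i Delta phi_j)] for wreaths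
   [w_i = (C_i, phi_i)].  A wall {D, D^c} sees a wreath with [C] in [D] as the
   leaf (D, phi on D^c) of a star, and a wreath whose [C] it cuts as the center
   of that star; two wreaths lie on the same leaf iff some side D contains
   [F_ij].  The wall part of delta is the integral over the walls of these star
   metrics, which are median.  So the median of [w_1, w_2, w_3] has the pointwise
   median as its map, and for its set a convex [M] contained in a halfspace D iff
   some [F_ij] is; such an [M] is obtained as the hull of iterated gates.
   Everything about walls then reduces to inclusions between the sets
   [walls_of F_ij], and to mu(A U B) + mu(A n B) = mu(A) + mu(B). *)

Require Import Defs.
From HB Require Import structures.
From mathcomp Require Import all_boot all_order all_algebra.
From mathcomp Require Import finmap.
From mathcomp Require Import all_classical all_reals all_analysis.
From mathcomp Require Import lra.

Set Implicit Arguments.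
Unset Strict Implicit.
Unset Printing Implicit Defensive.

Import Order.TTheory GRing.Theory Num.Theory.

Local Open Scope classical_set_scope.
Local Open Scope ring_scope.


(** * Halfspaces, gates and walls in a median space *)

Section MedianGeometry.
Context {R : realType} {Y : metricType R}.
Hypothesis hY : median_space (@mdist R Y).
Implicit Types (D F : set Y) (x y z m p q : Y) (h : set (set Y)).

Local Notation I := (ival (@mdist R Y)).

Lemma median_exists x y z : exists m, [/\ I x y m, I y z m & I x z m].
Proof.
have [m e] := hY.2 x y z.
have : [set m] m by [].
by rewrite -e => -[[? ?] ?]; exists m.
Qed.

Lemma halfspaceC D : halfspace D -> halfspace (~` D).
Proof. by case=> ? ?; split; rewrite ?setCK. Qed.

(** Majority vote: of three points, two lie on the same side of [D], and that side, being convex,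
    contains the median. *)
Lemma halfspace_median D x y z m : halfspace D ->
  I x y m -> I y z m -> I x z m ->
  D m <-> (D x /\ D y) \/ (D y /\ D z) \/ (D x /\ D z).
Proof.
move=> [cD cDC] ixy iyz ixz; split.
  move=> Dm; apply: contrapT => /not_orP[/not_andP nxy].
  move=> /not_orP[/not_andP nyz /not_andP nxz].
  suff : (~` D) m by [].
  case: nxy => [nx|ny].
    case: nyz => [ny|nz]; first exact: (cDC x y).
    exact: (cDC x z).
  case: nxz => [nx|nz]; first exact: (cDC x y).
  exact: (cDC y z).
by move=> [[? ?]|[[? ?]|[? ?]]]; [exact: (cD x y)|exact: (cD y z)|exact: (cD x z)].
Qed.

Lemma mhull_sub F : F `<=` mhull F.
Proof. exact: sub_smallest. Qed.

Lemma mhull_convex F : mconvex (mhull F).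
Proof.
by move=> x y Fx Fy z Iz A [cA FA]; apply: (cA x y) => //; [exact: Fx|exact: Fy].
Qed.

Lemma mhull_subP F D : mconvex D -> mhull F `<=` D <-> F `<=` D.
Proof.
move=> cD; split; first exact: subset_trans (@mhull_sub F).
by move=> FD; apply: smallest_sub.
Qed.

(** The point [q] is the gate of [x] in the hull of [F], described by the halfspaces containing it.
    Induction on a list of [F]: if [p] is the gate for the points so far and [s1] is a new point,
    the median of [x], [p], [s1] is the new gate. *)
Lemma mhull_gate F x : finite_set F -> F !=set0 ->
  exists q, mhull F q /\ forall D, halfspace D ->
    D q <-> F `<=` D \/ (D x /\ F `&` D !=set0).
Proof.
move=> /finite_seqP[s ->]; case: s => [[y]|s0 s _]; first by [].
elim: s => [|s1 s [p [hp Hp]]].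
  exists s0; split; first by apply: mhull_sub => /=; rewrite inE.
  move=> D hD; split.
    by move=> D0; left => y /=; rewrite inE => /eqP ->.
  case; first by apply; rewrite /= inE.
  by move=> [_ [y [/=]]]; rewrite inE => /eqP ->.
have sub : [set` s0 :: s] `<=` [set` [:: s0, s1 & s]].
  by move=> y /=; rewrite !inE => /orP[->|->] //; rewrite !orbT.
have [m [i1 i2 i3]] := median_exists x p s1.
exists m; split.
  apply: (@mhull_convex _ p s1) => //.
    move=> A [cA sA]; apply: hp; split=> //; exact: subset_trans sA.
  by apply: mhull_sub; rewrite /= !inE eqxx orbT.
move=> D hD; rewrite (halfspace_median hD i1 i2 i3) Hp //.
have e1 : [set` [:: s0, s1 & s]] `<=` D <-> [set` s0 :: s] `<=` D /\ D s1.
  split.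
    move=> sD; split; first exact: subset_trans sD.
    by apply: sD; rewrite /= !inE eqxx orbT.
  move=> [sD D1] y /=; rewrite !inE => /or3P[y0|/eqP->//|ys]; apply: sD.
    by rewrite /= inE y0.
  by rewrite /= inE ys orbT.
have e2 : [set` [:: s0, s1 & s]] `&` D !=set0 <->
    [set` s0 :: s] `&` D !=set0 \/ D s1.
  split.
    move=> [y [/=]]; rewrite !inE => /or3P[y0|/eqP->|ys] Dy; [left|by right|left];
      by exists y; split=> //=; rewrite inE ?y0 ?ys ?orbT.
  move=> [[y [ys Dy]]|D1]; first by exists y; split=> //; exact: sub.
  by exists s1; split=> //=; rewrite !inE eqxx orbT.
have e3 : [set` s0 :: s] `<=` D -> [set` s0 :: s] `&` D !=set0.
  by move=> sD; exists s0; split; [|apply: sD]; rewrite /= inE eqxx.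
rewrite e1 e2; tauto.
Qed.

(* The set produced is the set of gates in [mhull B] of the points of [A]; its
   hull is [mhull A `&` mhull B]. *)
Lemma finite_meet (A B : set Y) : finite_set A -> finite_set B ->
  A !=set0 -> B !=set0 ->
  (forall D, halfspace D -> A `<=` D -> B `&` D !=set0) ->
  exists T : set Y, [/\ finite_set T, T !=set0 &
    forall D, halfspace D -> T `<=` D <-> A `<=` D \/ B `<=` D].
Proof.
move=> fA fB nA nB AB.
have /choice[g Hg] := fun x => mhull_gate x fB nB.
exists (g @` A); split; first exact: finite_image.
  by case: nA => a Aa; exists (g a); exists a.
move=> D hD; split.
  move=> gD; apply: contrapT => /not_orP[nAD nBD]; apply: nAD => a Aa.
  have /((Hg a).2 D hD) : D (g a) by apply: gD; exists a.
  by case=> [|[]].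
move=> AorB _ [a Aa <-]; apply/((Hg a).2 D hD).
case: AorB => [AD|BD]; [right|by left].
by split; [exact: AD|exact: AB].
Qed.

(** Halfspaces, hence walls, cannot tell [F] from a finite set. Unlike [fg_convex], this is stable
    under unions and so applies to the sets $F_{ij}$, which need not be convex. *)
Definition finite_span (F : set Y) : Prop :=
  exists S : set Y, [/\ finite_set S, S !=set0 &
    forall D, halfspace D -> F `<=` D <-> S `<=` D].

Lemma hyperplane_sides h D : hyperplanes h -> h D ->
  [/\ halfspace D, h = [set D; ~` D] & h (~` D)].
Proof.
move=> [E [hE _ _ ->]] /= [] ->; split=> //.
- by right.
- exact: halfspaceC.
- by rewrite setCK setUC.
- by rewrite setCK; left.
Qed.

Lemma hyperplane_side_at h p : hyperplanes h -> exists D, h D /\ D p.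
Proof.
move=> [D [_ _ _ ->]]; have [Dp|nDp] := pselect (D p).
  by exists D; split=> //; left.
by exists (~` D); split=> //; right.
Qed.

Lemma hyperplane_side_uniq h D D' p : hyperplanes h -> h D -> h D' ->
  D p -> D' p -> D = D'.
Proof.
by move=> hh hD; have [_ -> _] := hyperplane_sides hh hD => -[] -> // Dp /(_ Dp).
Qed.

Lemma walls_ofP F h : walls_of F h <-> hyperplanes h /\ forall D, h D -> ~ (F `<=` D).
Proof.
split.
  move=> [hh [x [y [Fx Fy [D [hD Dx Dy]]]]]]; split=> // D' hD' FD'.
  have e := hyperplane_side_uniq hh hD hD' Dx (FD' _ Fx); subst D'.
  exact: Dy (FD' _ Fy).
move=> [hh nF]; split=> //.
have [D [_ _ _ eh]] := hh.
have hD : h D by rewrite eh; left.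
have [_ _ hDC] := hyperplane_sides hh hD.
have /existsNP[x /not_implyP[Fx nDx]] := nF _ hD.
have /existsNP[y /not_implyP[Fy nDCy]] := nF _ hDC.
exists x, y; split=> //; exists (~` D); split=> //.
Qed.

Lemma not_walls_ofP F h : hyperplanes h -> ~ walls_of F h <-> exists D, h D /\ F `<=` D.
Proof.
move=> hh; rewrite walls_ofP; split.
  move=> /not_andP[//|/existsNP[D /not_implyP[hD /contrapT FD]]].
  by exists D.
by move=> [D [hD FD]] [_ /(_ D hD)].
Qed.

Lemma walls_of_sub F F' : F `<=` F' -> walls_of F `<=` walls_of F'.
Proof.
move=> FF' h [hh [x [y [Fx Fy hxy]]]]; split=> //.
by exists x, y; split=> //; exact: FF'.
Qed.

(** A wall cuts [F] iff it cuts the finite set [S], that is, iff it separates a fixed [x0] of [S]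
    from another point of [S]. Measurability and finite measure of [walls_of F] follow. *)
Lemma finite_span_walls F : finite_span F ->
  exists x0 (S : seq Y), walls_of F = \big[setU/set0]_(y <- S) walls x0 y.
Proof.
move=> [S [/finite_seqP[s ->] [x0 sx0] FS]]; exists x0, s.
rewrite -bigcup_seq; apply/seteqP; split=> h.
  move=> [hh [x [y [Fx Fy hxy]]]].
  have /walls_ofP[_ nF] : walls_of F h by split=> //; exists x, y.
  have [D [hD Dx0]] := hyperplane_side_at x0 hh.
  have [halfD _ _] := hyperplane_sides hh hD.
  have /existsNP[z /not_implyP[sz nDz]] : ~ ([set` s] `<=` D).
    by move/(FS D halfD); exact: nF.
  by exists z => //; split=> //; exists D.
move=> [y sy [hh [D [hD Dx0 Dy]]]]; apply/walls_ofP; split=> // D' hD'.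
have [halfD' _ _] := hyperplane_sides hh hD'.
move=> /(FS D' halfD') sD'.
have e := hyperplane_side_uniq hh hD hD' Dx0 (sD' _ sx0); subst D'.
exact: Dy (sD' _ sy).
Qed.

Lemma fg_convex_span (C : set Y) : fg_convex C -> finite_span C.
Proof.
move=> [S [fS nS ->]]; exists S; split=> // D [cD _]; exact: mhull_subP.
Qed.

Lemma fg_convex_hull (T : set Y) : finite_set T -> T !=set0 ->
  exists C, fg_convex C /\ forall D, halfspace D -> C `<=` D <-> T `<=` D.
Proof.
move=> fT nT; exists (mhull T); split; first by exists T.
by move=> D [cD _]; exact: mhull_subP.
Qed.

Lemma fg_convex_neq0 (C : set Y) : fg_convex C -> C !=set0.
Proof. by move=> [S [_ [x Sx] ->]]; exists x; exact: mhull_sub. Qed.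

Lemma finite_spanU F F' : finite_span F -> finite_span F' -> finite_span (F `|` F').
Proof.
move=> [S [fS [x Sx] hS]] [S' [fS' _ hS']]; exists (S `|` S'); split.
- by rewrite finite_setU.
- by exists x; left.
by move=> D hD; rewrite !subUset hS // hS'.
Qed.

Lemma finite_spanUfin F E : finite_span F -> finite_set E -> finite_span (F `|` E).
Proof.
move=> [S [fS [x Sx] hS]] fE; exists (S `|` E); split.
- by rewrite finite_setU.
- by exists x; left.
by move=> D hD; rewrite !subUset hS.
Qed.

(** Take for [q] the gate of [p] in [C]. A halfspace containing [p] but not [q] misses all
    generators of [C], so its complement contains [C] and the wall does not cut [C]. *)
Lemma fg_convex_gate (C : set Y) p : fg_convex C -> ~ C p ->
  exists q, [/\ C q, p != q & walls p q `&` walls_of C = set0].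
Proof.
move=> [S [fS nS ->]] nCp; have [q [Cq Hq]] := mhull_gate p fS nS.
exists q; split=> //; first by apply: contra_notN nCp => /eqP ->.
apply/seteqP; split=> // h [[hh [D [hD Dp nDq]]] /walls_ofP[_ nC]].
have [halfD _ hDC] := hyperplane_sides hh hD.
apply: (nC _ hDC); apply/mhull_subP; first exact: halfD.2.
move=> s Ss Ds; apply: nDq; apply/(Hq D halfD); right; split=> //.
by exists s.
Qed.

End MedianGeometry.

(** * Real-valued arithmetic of sets of finite measure *)

Section FiniteMeasure.
Context d (R : realType) (T : measurableType d) (mu : {measure set T -> \bar R}).
Implicit Types A B U V N : set T.

Definition finitely_measured A : Prop := measurable A /\ (mu A < +oo)%E.

Lemma fineK_measured A : finitely_measured A -> (fine (mu A))%:E = mu A.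
Proof. by move=> [_ Aoo]; rewrite fineK // ge0_fin_numE. Qed.

Lemma finitely_measuredS A B : measurable A -> A `<=` B -> finitely_measured B ->
  finitely_measured A.
Proof.
move=> mA AB [mB Boo]; split=> //; apply: le_lt_trans Boo.
by apply: le_measure; rewrite ?inE.
Qed.

Lemma finitely_measuredU A B : finitely_measured A -> finitely_measured B ->
  finitely_measured (A `|` B).
Proof.
move=> [mA Aoo] [mB Boo]; split; first exact: measurableU.
by apply: le_lt_trans (measureU2 _ _ _) _ => //; rewrite lte_add_pinfty.
Qed.

Lemma finitely_measuredI A B : finitely_measured A -> finitely_measured B ->
  finitely_measured (A `&` B).
Proof.
move=> fA [mB _]; apply: (finitely_measuredS _ _ (fA)); last exact: subIsetl.
by apply: measurableI => //; case: fA.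
Qed.

Lemma finitely_measuredD A B : finitely_measured A -> finitely_measured B ->
  finitely_measured (A `\` B).
Proof.
move=> fA [mB _]; apply: (finitely_measuredS _ _ (fA)); last exact: subDsetl.
by apply: measurableD => //; case: fA.
Qed.

Lemma le_fine_measure A B : finitely_measured A -> finitely_measured B ->
  A `<=` B -> fine (mu A) <= fine (mu B).
Proof.
move=> fA fB AB; rewrite -lee_fin !fineK_measured //.
by apply: le_measure; rewrite ?inE //; [case: fA|case: fB].
Qed.

Lemma fine_measureUI A B : finitely_measured A -> finitely_measured B ->
  fine (mu (A `|` B)) + fine (mu (A `&` B)) = fine (mu A) + fine (mu B).
Proof.
move=> fA fB; apply/EFin_inj; rewrite !EFinD !fineK_measured //.
- have fI := finitely_measuredI fA fB.
  rewrite measureUfinl; [|by case: fA|by case: fB|by case: fA].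
  by rewrite subeK // ge0_fin_numE //; case: fI.
- exact: finitely_measuredI.
- exact: finitely_measuredU.
Qed.

Lemma fine_measureD A B : finitely_measured A -> finitely_measured B -> B `<=` A ->
  fine (mu (A `\` B)) = fine (mu A) - fine (mu B).
Proof.
move=> fA fB BA; have fD := finitely_measuredD fA fB.
have := fine_measureUI fB fD.
rewrite setDIK setDUK // measure0 /=; lra.
Qed.

Section Crossing.
Context (A B U V : set T).
Hypotheses (fA : finitely_measured A) (fB : finitely_measured B).
Hypotheses (fU : finitely_measured U) (fV : finitely_measured V).
Hypotheses (UAB : U `<=` A `|` B) (VAB : V `<=` A `&` B).

(** Abstract triangle inequality for the wall part of delta: [A], [B], [U] stand for the walls
    cutting $F_{12}$, $F_{23}$, $F_{13}$, and [V] for those cutting $C_2$. *)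
Lemma fine_measure_cross :
  fine (mu U) + fine (mu V) <= fine (mu A) + fine (mu B).
Proof.
rewrite -(fine_measureUI fA fB); apply: lerD.
  exact: le_fine_measure fU (finitely_measuredU fA fB) UAB.
exact: le_fine_measure fV (finitely_measuredI fA fB) VAB.
Qed.

(** Equality case: the two inclusions have nonnegative defects whose sum vanishes, so both defects
    are null. *)
Lemma fine_measure_cross_eq :
  fine (mu U) + fine (mu V) = fine (mu A) + fine (mu B) ->
  fine (mu ((A `|` B) `\` U)) = 0 /\ fine (mu ((A `&` B) `\` V)) = 0.
Proof.
have fI := finitely_measuredI fA fB.
have fUn := finitely_measuredU fA fB.
rewrite -(fine_measureUI fA fB) !fine_measureD //.
have := le_fine_measure fU fUn UAB.
have := le_fine_measure fV fI VAB.
lra.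
Qed.

End Crossing.

Lemma le_fine_measureU3 A V N1 N2 N3 :
  finitely_measured A -> finitely_measured V -> finitely_measured N1 ->
  finitely_measured N2 -> finitely_measured N3 ->
  fine (mu N1) = 0 -> fine (mu N2) = 0 -> fine (mu N3) = 0 ->
  A `<=` V `|` (N1 `|` (N2 `|` N3)) -> fine (mu A) <= fine (mu V).
Proof.
move=> fA fV f1 f2 f3 n1 n2 n3 AV.
have U A' B' : finitely_measured A' -> finitely_measured B' ->
    fine (mu (A' `|` B')) <= fine (mu A') + fine (mu B').
  move=> fA' fB'; rewrite -(fine_measureUI fA' fB') lerDl.
  by rewrite fine_ge0.
have f23 := finitely_measuredU f2 f3.
have f123 := finitely_measuredU f1 f23.
have f0 := finitely_measuredU fV f123.
have := le_fine_measure fA f0 AV.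
have := U _ _ fV f123; have := U _ _ f1 f23; have := U _ _ f2 f3.
lra.
Qed.

End FiniteMeasure.

(** * Spans of pairs of wreaths, and the construction of the median wreath *)

Section Wreaths.
Context {R : realType} {X Y : metricType R} {x0 : X}.
Hypothesis hX : median_space (@mdist R X).
Implicit Types (w m : diadem X Y x0) (D F : set Y).

Lemma wreath_eq w1 w2 : wreath_set w1 = wreath_set w2 ->
  wreath_map w1 = wreath_map w2 -> w1 = w2.
Proof.
case: w1 w2 => [C1 f1 p1 q1] [C2 f2 p2 q2] /= eC ef; subst C2 f2.
by rewrite (Prop_irrelevance p1 p2) (Prop_irrelevance q1 q2).
Qed.

Definition wspan w1 w2 : set Y :=
  wreath_set w1 `|` wreath_set w2 `|` map_diff (wreath_map w1) (wreath_map w2).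

Lemma wspanC w1 w2 : wspan w1 w2 = wspan w2 w1.
Proof.
rewrite /wspan [X in X `|` _]setUC; congr setU.
by apply/seteqP; split=> y /= ne /esym.
Qed.

Lemma wspan_subP w1 w2 D : wspan w1 w2 `<=` D <->
  [/\ wreath_set w1 `<=` D, wreath_set w2 `<=` D &
    forall y, ~ D y -> wreath_map w1 y = wreath_map w2 y].
Proof.
rewrite /wspan !subUset; split.
  move=> [[? ?] fD]; split=> // y nDy; apply: contrapT => nf.
  exact: nDy (fD _ nf).
by move=> [? ? e]; split=> // y nf; apply: contrapT => nD; apply: nf; exact: e.
Qed.

(** Agreement of the maps off [D] is transitive, so lying on the leaf of [D] is too. *)
Lemma wspan_trans w2 w1 w3 D :
  wspan w1 w2 `<=` D -> wspan w2 w3 `<=` D -> wspan w1 w3 `<=` D.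
Proof.
move=> /wspan_subP[s1 s2 e12] /wspan_subP[_ s3 e23]; apply/wspan_subP.
by split=> // y nD; rewrite e12 ?e23.
Qed.

Lemma finite_map_diff w1 w2 :
  finite_set (map_diff (wreath_map w1) (wreath_map w2)).
Proof.
apply: (@sub_finite_set _ _ ([set y | wreath_map w1 y <> x0] `|`
    [set y | wreath_map w2 y <> x0])).
  move=> y /= n12; apply: contrapT => /not_orP[/contrapT e1 /contrapT e2].
  by apply: n12; rewrite e1 e2.
by rewrite finite_setU; split; exact: wreath_mapP.
Qed.

Lemma finite_span_wreath w : finite_span (wreath_set w).
Proof. exact: fg_convex_span (wreath_setP w). Qed.

Lemma finite_span_wspan w1 w2 : finite_span (wspan w1 w2).
Proof.
apply: finite_spanUfin; last exact: finite_map_diff.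
by apply: finite_spanU; exact: finite_span_wreath.
Qed.

Lemma ival_eq (x y m : X) : ival (@mdist R X) x y m -> x = y -> m = x.
Proof.
move=> + xy; subst y => /=.
have [[d0 d_eq0 dC _] _] := hX.
rewrite /ival /= d0 (dC m) => e; apply/esym/d_eq0; lra.
Qed.

(** The set is prescribed only through the halfspaces containing it, which is all that walls see. *)
Record wreath_median m w1 w2 w3 : Prop := WreathMedian {
  wreath_median_set : forall D, halfspace D -> wreath_set m `<=` D <->
    [\/ wspan w1 w2 `<=` D, wspan w2 w3 `<=` D | wspan w1 w3 `<=` D];
  wreath_median_map : forall y, [/\
    ival (@mdist R X) (wreath_map w1 y) (wreath_map w2 y) (wreath_map m y),
    ival (@mdist R X) (wreath_map w2 y) (wreath_map w3 y) (wreath_map m y) &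
    ival (@mdist R X) (wreath_map w1 y) (wreath_map w3 y) (wreath_map m y)]
}.

Lemma wreath_median_exists w1 w2 w3 : median_space (@mdist R Y) ->
  exists m, wreath_median m w1 w2 w3.
Proof.
move=> hY.
have [S12 [f12 n12 e12]] := finite_span_wspan w1 w2.
have [S23 [f23 n23 e23]] := finite_span_wspan w2 w3.
have [S13 [f13 n13 e13]] := finite_span_wspan w1 w3.
(* Condition for [finite_meet]: a nonempty wreath set lying in both [D] and [F] prevents [F], hence
   [S], from lying in the complement of [D]. *)
have meet w (S F : set Y) D : halfspace D ->
    (forall D, halfspace D -> F `<=` D <-> S `<=` D) ->
    wreath_set w `<=` F -> wreath_set w `<=` D -> S `&` D !=set0.
  move=> hD FS wF wD; apply: contrapT => /nonemptyPn /disjoints_subset SD.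
  have [x wx] := fg_convex_neq0 (wreath_setP w).
  have FD : F `<=` ~` D by apply/FS => //; exact: halfspaceC.
  exact: FD (wF _ wx) (wD _ wx).
have [T [fT nT eT]] : exists T : set Y, [/\ finite_set T, T !=set0 &
    forall D, halfspace D -> T `<=` D <-> S12 `<=` D \/ S23 `<=` D].
  apply: finite_meet => // D hD /(e12 D hD) /wspan_subP[_ w2D _].
  by apply: (meet w2 S23 (wspan w2 w3)) => // y; left; left.
have [T' [fT' nT' eT']] : exists T' : set Y, [/\ finite_set T', T' !=set0 &
    forall D, halfspace D -> T' `<=` D <-> T `<=` D \/ S13 `<=` D].
  apply: finite_meet => // D hD /(eT D hD)[].
    move=> /(e12 D hD) /wspan_subP[w1D _ _].
    by apply: (meet w1 S13 (wspan w1 w3)) => // y; left; left.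
  move=> /(e23 D hD) /wspan_subP[_ w3D _].
  by apply: (meet w3 S13 (wspan w1 w3)) => // y; left; right.
have [C [fgC eC]] := fg_convex_hull fT' nT'.
have /choice[f Hf] := fun y =>
  median_exists hX (wreath_map w1 y) (wreath_map w2 y) (wreath_map w3 y).
(* Where the first two maps both equal [x0], so does the median, because an interval with equal ends
   is a point. *)
have ff : finite_set [set y | f y <> x0].
  apply: (@sub_finite_set _ _ ([set y | wreath_map w1 y <> x0] `|`
    [set y | wreath_map w2 y <> x0])).
    move=> y /= nf; apply: contrapT => /not_orP[/contrapT e1 /contrapT e2].
    apply: nf; have [i1 _ _] := Hf y.
    by rewrite (ival_eq i1) ?e1 ?e2.
  by rewrite finite_setU; split; exact: wreath_mapP.
exists (Wreath fgC ff); split=> //= D hD.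
rewrite eC // eT' // eT // -e12 // -e23 // -e13 //.
split; first by move=> [[s|s]|s]; [constructor 1|constructor 2|constructor 3].
by case=> s; [left; left|left; right|right].
Qed.

Lemma ivalC (x y z : X) : ival (@mdist R X) x y z -> ival (@mdist R X) y x z.
Proof.
by have [[_ _ dC _] _] := hX; rewrite /ival /= (dC y x) (dC y z) (dC z x) addrC.
Qed.

(** Together with the swap below, this generates all permutations of the three wreaths, so later
    facts need proof for one pair only. *)
Lemma wreath_median_rot m w1 w2 w3 :
  wreath_median m w1 w2 w3 -> wreath_median m w2 w3 w1.
Proof.
move=> [hs hm]; split=> [D hD|y]; last first.
  by have [i12 i23 i13] := hm y; split; [exact: i23|exact: ivalC|exact: ivalC].
rewrite hs // (wspanC w3 w1) (wspanC w2 w1).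
split; first by case=> s; [constructor 3|constructor 1|constructor 2].
by case=> s; [constructor 2|constructor 3|constructor 1].
Qed.

Lemma wreath_median_swap m w1 w2 w3 :
  wreath_median m w1 w2 w3 -> wreath_median m w2 w1 w3.
Proof.
move=> [hs hm]; split=> [D hD|y]; last first.
  by have [i12 i23 i13] := hm y; split; [exact: ivalC|exact: i13|exact: i23].
rewrite hs // (wspanC w2 w1).
split; first by case=> s; [constructor 1|constructor 3|constructor 2].
by case=> s; [constructor 1|constructor 3|constructor 2].
Qed.

(** If two wreaths share a leaf, the median joins them: off [D] their maps agree, and the pointwise
    median takes the common value. *)
Lemma wspan_median_sub m w1 w2 w3 D : halfspace D -> wreath_median m w1 w2 w3 ->
  wspan w1 w2 `<=` D -> wspan w1 m `<=` D.
Proof.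
move=> hD [hs hm] s12.
have sm : wreath_set m `<=` D by apply/hs => //; constructor 1.
move/wspan_subP: s12 => [s1 s2 e]; apply/wspan_subP; split=> // y nD.
have [i1 _ _] := hm y.
by rewrite (ival_eq i1) // e.
Qed.

End Wreaths.

(** * Walls cutting the spans and the median *)

Section Walls.
Context {R : realType} {X Y : metricType R} {x0 : X}.
Hypothesis hX : median_space (@mdist R X).
Implicit Types (w m : diadem X Y x0) (h : set (set Y)).

(** If a wall cuts neither span on the right, the two sides containing them both contain the
    nonempty set of [w2], hence coincide, and [wspan_trans] applies. *)
Lemma walls_of_wspan_trans w2 w1 w3 :
  walls_of (wspan w1 w3) `<=` walls_of (wspan w1 w2) `|` walls_of (wspan w2 w3).
Proof.
move=> h W13; have [hh _] := W13; apply: contrapT => /not_orP[].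
move=> /(not_walls_ofP _ hh)[D [hD s12]] /(not_walls_ofP _ hh)[D' [hD' s23]].
have [y w2y] := fg_convex_neq0 (wreath_setP w2).
have Dy : D y by apply: s12; left; right.
have D'y : D' y by apply: s23; left; left.
have e := hyperplane_side_uniq hh hD hD' Dy D'y; subst D'.
by have /walls_ofP[_ /(_ _ hD)] := W13; apply; exact: wspan_trans s23.
Qed.

Lemma walls_of_wreath_sub w1 w2 w3 :
  walls_of (wreath_set w2) `<=` walls_of (wspan w1 w2) `&` walls_of (wspan w2 w3).
Proof.
by rewrite subsetI; split; apply: walls_of_sub => y wy; left; [right|left].
Qed.

Lemma walls_of_median m w1 w2 w3 : wreath_median m w1 w2 w3 ->
  walls_of (wreath_set m) =
    walls_of (wspan w1 w2) `&` walls_of (wspan w2 w3) `&` walls_of (wspan w1 w3).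
Proof.
move=> [hs _]; apply/seteqP; split=> h.
  move=> /walls_ofP[hh nm]; split; [split|];
    apply/walls_ofP; split=> // D hD sD; apply: (nm _ hD);
    have [halfD _ _] := hyperplane_sides hh hD; apply/(hs D halfD).
  - by constructor 1.
  - by constructor 2.
  - by constructor 3.
move=> [[/walls_ofP[hh n12] /walls_ofP[_ n23]] /walls_ofP[_ n13]].
apply/walls_ofP; split=> // D hD.
have [halfD _ _] := hyperplane_sides hh hD.
by move=> /(hs D halfD)[]; [exact: n12|exact: n23|exact: n13].
Qed.

(** In the star of a wall, the median shares the leaf of [w1] iff [w2] or [w3] does. *)
Lemma walls_of_wspan_median m w1 w2 w3 : wreath_median m w1 w2 w3 ->
  walls_of (wspan w1 m) = walls_of (wspan w1 w2) `&` walls_of (wspan w1 w3).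
Proof.
move=> hm; have hm231 := wreath_median_rot hX hm.
have hm132 := wreath_median_swap hX (wreath_median_rot hX hm231).
apply/seteqP; split=> h.
  move=> /walls_ofP[hh n1m]; split; apply/walls_ofP; split=> // D hD sD;
    have [halfD _ _] := hyperplane_sides hh hD; apply: (n1m _ hD).
    exact: wspan_median_sub hm sD.
  exact: wspan_median_sub hm132 sD.
move=> [/walls_ofP[hh n12] /walls_ofP[_ n13]]; apply/walls_ofP; split=> // D hD s1m.
have [halfD _ _] := hyperplane_sides hh hD.
have /wspan_subP[_ sm _] := s1m.
have /(wreath_median_set hm halfD)[s12|s23|s13] := sm.
- exact: n12 hD s12.
(* Here [w2] and [w3] share the leaf, so [m] joins them there; [w1] shares it with [m], hence with
   [w2]. *)
- apply: (n12 _ hD); apply: wspan_trans s1m _.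
  by rewrite wspanC; exact: wspan_median_sub hm231 s23.
- exact: n13 hD s13.
Qed.

Lemma walls_of_median_sub m m' w1 w2 w3 : wreath_median m w1 w2 w3 ->
  walls_of (wspan m m') `<=` walls_of (wspan w1 m') `|` walls_of (wspan w1 w2).
Proof.
move=> hm h /(walls_of_wspan_trans w1)[|]; last by left.
by rewrite wspanC (walls_of_wspan_median hm) => -[]; right.
Qed.

End Walls.

(** * Wall part of delta: pseudometric, intervals and medians *)

Section Diadem.
Context {R : realType} {X Y : metricType R} {x0 : X}.
Hypothesis hX : median_space (@mdist R X).
Hypothesis hY : median_space (@mdist R Y).
Context {G : set (set (set (set Y)))}.
Context (mu : {measure set (g_sigma_algebraType G) -> \bar R}).
Hypothesis hmu : hyperplane_measure mu.
Implicit Types (w m : diadem X Y x0).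

Lemma walls_measured x y : finitely_measured mu (walls x y : set (g_sigma_algebraType G)).
Proof.
have [_ _ Gw muw] := hmu; split; last by rewrite muw ltry.
exact: sub_sigma_algebra (Gw x y).
Qed.

Lemma walls_of_measured (F : set Y) : finite_span F ->
  finitely_measured mu (walls_of F : set (g_sigma_algebraType G)).
Proof.
move=> /finite_span_walls[y0 [S ->]].
apply: (big_ind (fun A : set (g_sigma_algebraType G) => finitely_measured mu A)).
- by split; [exact: measurable0|rewrite measure0].
- exact: finitely_measuredU.
- by move=> y _; exact: walls_measured.
Qed.

Lemma measured_wspan w1 w2 :
  finitely_measured mu (walls_of (wspan w1 w2) : set (g_sigma_algebraType G)).
Proof. exact/walls_of_measured/finite_span_wspan. Qed.

Lemma measured_wreath w :
  finitely_measured mu (walls_of (wreath_set w) : set (g_sigma_algebraType G)).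
Proof. exact/walls_of_measured/finite_span_wreath. Qed.

Hint Resolve measured_wspan measured_wreath : core.

Definition wall_dist w1 w2 : R := 2 * wall_measure mu (wspan w1 w2)
  - wall_measure mu (wreath_set w1) - wall_measure mu (wreath_set w2).

Definition lamp_dist w1 w2 : R :=
  \sum_(y \in [set: Y]) mdist (wreath_map w1 y) (wreath_map w2 y).

Lemma diadem_distE w1 w2 : diadem_dist mu w1 w2 = wall_dist w1 w2 + lamp_dist w1 w2.
Proof. by case: w1 w2 => [C1 f1 p1 q1] [C2 f2 p2 q2]. Qed.

Lemma wall_distxx w : wall_dist w w = 0.
Proof.
rewrite /wall_dist; have -> : wspan w w = wreath_set w; last lra.
by rewrite /wspan setUid; apply/setUidPl => y [].
Qed.

Lemma wall_distC w1 w2 : wall_dist w1 w2 = wall_dist w2 w1.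
Proof. rewrite /wall_dist wspanC; lra. Qed.

Lemma wall_dist_triangle w2 w1 w3 :
  wall_dist w1 w3 <= wall_dist w1 w2 + wall_dist w2 w3.
Proof.
rewrite /wall_dist /wall_measure.
have := fine_measure_cross (measured_wspan w1 w2) (measured_wspan w2 w3)
  (measured_wspan w1 w3) (measured_wreath w2)
  (@walls_of_wspan_trans _ _ _ _ w2 w1 w3) (@walls_of_wreath_sub _ _ _ _ w1 w2 w3).
lra.
Qed.

Lemma wall_dist_ge0 w1 w2 : 0 <= wall_dist w1 w2.
Proof.
have := wall_dist_triangle w2 w1 w1; rewrite wall_distxx (wall_distC w2); lra.
Qed.

(** If [p] were in [F] but not in [C], the walls between [p] and its gate [q] in [C] would cut [F]
    and not [C], and their measure $d(p,q)$ is positive. *)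
Lemma wall_measure_eq_sub (C F : set Y) : fg_convex C -> finite_span F ->
  C `<=` F -> wall_measure mu F = wall_measure mu C -> F `<=` C.
Proof.
move=> fgC fF CF eFC p Fp; apply: contrapT => nCp.
have [q [Cq pq disj]] := fg_convex_gate hY fgC nCp.
have fWF := walls_of_measured fF.
have fWC := walls_of_measured (fg_convex_span fgC).
have e0 := fine_measureD fWF fWC (walls_of_sub CF).
have sub : walls p q `<=` walls_of F `\` walls_of C.
  move=> h pqh; split.
    by case: pqh => hh sep; split=> //; exists p, q; split=> //; exact: CF.
  by move=> Ch; have : (walls p q `&` walls_of C) h by []; rewrite disj.
have := le_fine_measure (walls_measured p q) (finitely_measuredD fWF fWC) sub.
have [_ _ _ ->] := hmu; rewrite e0 /=.
rewrite /wall_measure in eFC; rewrite eFC subrr => d0.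
by move: pq; rewrite -(mdist_gt0 p q) ltNge d0.
Qed.

(** Each set has measure at most that of the span, so distance zero forces equality in both bounds,
    and each set equals the span. *)
Lemma wall_dist_eq0 w1 w2 : wall_dist w1 w2 = 0 -> wreath_set w1 = wreath_set w2.
Proof.
have s1 : wreath_set w1 `<=` wspan w1 w2 by move=> y; left; left.
have s2 : wreath_set w2 `<=` wspan w1 w2 by move=> y; left; right.
have := le_fine_measure (measured_wreath w1) (measured_wspan w1 w2) (walls_of_sub s1).
have := le_fine_measure (measured_wreath w2) (measured_wspan w1 w2) (walls_of_sub s2).
rewrite /wall_dist /wall_measure => l1 l2 e.
have t1 : wspan w1 w2 `<=` wreath_set w1.
  by apply: wall_measure_eq_sub => //;
    [exact: wreath_setP|exact: finite_span_wspan|rewrite /wall_measure; lra].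
have t2 : wspan w1 w2 `<=` wreath_set w2.
  by apply: wall_measure_eq_sub => //;
    [exact: wreath_setP|exact: finite_span_wspan|rewrite /wall_measure; lra].
by apply/seteqP; split; [exact: subset_trans t2|exact: subset_trans t1].
Qed.

(** Inclusion-exclusion for the walls cutting the spans of [w1], [m] and of [m], [w2]: their union
    is the walls cutting $F_{12}$, their intersection those cutting the set of [m]. *)
Lemma wall_dist_median m w1 w2 w3 : wreath_median m w1 w2 w3 ->
  wall_dist w1 w2 = wall_dist w1 m + wall_dist m w2.
Proof.
move=> hm.
have := fine_measureUI (measured_wspan w1 m) (measured_wspan m w2).
have -> : walls_of (wspan w1 m) `|` walls_of (wspan m w2) = walls_of (wspan w1 w2).
  apply/seteqP; split; last exact: walls_of_wspan_trans.
  rewrite (wspanC m) (walls_of_wspan_median hX hm).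
  rewrite (walls_of_wspan_median hX (wreath_median_swap hX hm)) (wspanC w2 w1).
  by move=> h [[]|[]].
have -> : walls_of (wspan w1 m) `&` walls_of (wspan m w2) = walls_of (wreath_set m).
  rewrite (wspanC m) (walls_of_wspan_median hX hm) (walls_of_median hm).
  rewrite (walls_of_wspan_median hX (wreath_median_swap hX hm)) (wspanC w2 w1).
  by apply/seteqP; split=> h; [move=> [[? ?] [? ?]]|move=> [[? ?] ?]].
rewrite /wall_dist /wall_measure; lra.
Qed.

Lemma wall_dist_ival_null m w1 w2 :
  wall_dist w1 w2 = wall_dist w1 m + wall_dist m w2 ->
  fine (mu ((walls_of (wspan w1 m) `|` walls_of (wspan m w2)) `\`
             walls_of (wspan w1 w2))) = 0 /\
  fine (mu ((walls_of (wspan w1 m) `&` walls_of (wspan m w2)) `\`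
             walls_of (wreath_set m))) = 0.
Proof.
rewrite /wall_dist /wall_measure => e.
apply: (fine_measure_cross_eq (measured_wspan w1 m) (measured_wspan m w2)
  (measured_wspan w1 w2) (measured_wreath m)
  (@walls_of_wspan_trans _ _ _ _ m w1 w2) (@walls_of_wreath_sub _ _ _ _ w1 m w2)).
lra.
Qed.

(* Outside the null sets given by [wall_dist_ival_null], a wall that cuts
   [wspan m m'] cuts both [m] and [m']. *)
Lemma wall_dist_median_uniq m m' w1 w2 w3 : wreath_median m w1 w2 w3 ->
  wall_dist w1 w2 = wall_dist w1 m' + wall_dist m' w2 ->
  wall_dist w2 w3 = wall_dist w2 m' + wall_dist m' w3 ->
  wall_dist w1 w3 = wall_dist w1 m' + wall_dist m' w3 ->
  wall_dist m m' = 0.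
Proof.
move=> hm e12 e23 e13.
have hm2 := wreath_median_rot hX hm.
have hm3 := wreath_median_rot hX hm2.
have hm132 := wreath_median_swap hX hm3.
have [u12 v12] := wall_dist_ival_null e12.
have [u23 v23] := wall_dist_ival_null e23.
have [u13 v13] := wall_dist_ival_null e13.
have fD a b := finitely_measuredD (finitely_measuredU (measured_wspan a m')
  (measured_wspan m' b)) (measured_wspan a b).
have fI a b := finitely_measuredD (finitely_measuredI (measured_wspan a m')
  (measured_wspan m' b)) (measured_wreath m').
have side a b : walls_of (wspan m m') `<=`
      walls_of (wspan a m') `|` walls_of (wspan a b) ->
    forall h, walls_of (wspan m m') h -> walls_of (wspan a m') h \/
    walls_of (wspan m' b) h /\ walls_of (wspan a b) h.
  move=> sub h /sub[Wam|Wab]; first by left.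
  by have [|] := walls_of_wspan_trans m' Wab; [left|right].
have side12 := side _ _ (walls_of_median_sub hX (m' := m') hm).
have side23 := side _ _ (walls_of_median_sub hX (m' := m') hm2).
have side13 := side _ _ (walls_of_median_sub hX (m' := m') hm132).
have le' : fine (mu (walls_of (wspan m m'))) <= fine (mu (walls_of (wreath_set m'))).
  apply: (le_fine_measureU3 _ _ (fI _ _) (fI _ _) (fI _ _) v12 v23 v13) => //.
  (* By the [side] facts, [h] cuts at least two of the spans of [m'] with [w1], [w2], [w3]; off the
     [v] null sets it then cuts [m']. *)
  move=> h Wmm'; have [|nW] := pselect (walls_of (wreath_set m') h); first by left.
  right; have := side12 _ Wmm'; have := side23 _ Wmm'; have := side13 _ Wmm'.
  rewrite /= !(wspanC m') /setU /setI /setD /=; tauto.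
have le : fine (mu (walls_of (wspan m m'))) <= fine (mu (walls_of (wreath_set m))).
  apply: (le_fine_measureU3 _ _ (fD _ _) (fD _ _) (fD _ _) u12 u23 u13) => //.
  (* As two of those three spans are cut, each pair of indices involves a cut one; off the [u] null
     sets [h] then cuts every $F_{ij}$, hence [m]. *)
  move=> h Wmm'; rewrite (walls_of_median hm).
  have := side12 _ Wmm'; have := side23 _ Wmm'; have := side13 _ Wmm'.
  have := pselect (walls_of (wspan w1 w2) h).
  have := pselect (walls_of (wspan w2 w3) h).
  have := pselect (walls_of (wspan w1 w3) h).
  rewrite /= !(wspanC m') /setU /setI /setD /=; tauto.
have := wall_dist_ge0 m m'; rewrite /wall_dist /wall_measure; lra.
Qed.

(** * Lamp part of delta: the sum of distances between the maps *)

Lemma lamp_dist_excess w1 w2 w3 : exists s : seq Y,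
  [/\ forall y, y \notin s ->
        ival (@mdist R X) (wreath_map w1 y) (wreath_map w3 y) (wreath_map w2 y)
    & lamp_dist w1 w2 + lamp_dist w2 w3 - lamp_dist w1 w3 =
      \sum_(y <- s) (mdist (wreath_map w1 y) (wreath_map w2 y) +
        mdist (wreath_map w2 y) (wreath_map w3 y) -
        mdist (wreath_map w1 y) (wreath_map w3 y))].
Proof.
(* One finite set containing all three supports lets the three sums be compared term by term. *)
pose E := [set y | wreath_map w1 y <> x0] `|` [set y | wreath_map w2 y <> x0] `|`
          [set y | wreath_map w3 y <> x0].
have fE : finite_set E by rewrite !finite_setU; do !split; exact: wreath_mapP.
have out y : y \notin fset_set E ->
    [/\ wreath_map w1 y = x0, wreath_map w2 y = x0 & wreath_map w3 y = x0].
  rewrite in_fset_set // notin_setE => nE.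
  by split; apply: contrapT => n; apply: nE; [left; left|left; right|right].
exists (finmap.enum_fset (fset_set E)); split.
  by move=> y /out[-> -> ->]; rewrite /ival /= mdistxx addr0.
rewrite /lamp_dist !(fsbigTE (fset_set E));
  try by move=> y /out[e1 e2 e3]; rewrite ?e1 ?e2 ?e3 mdistxx.
by rewrite sumrB big_split.
Qed.

Lemma mdist_excess_ge0 (a b c : X) : 0 <= mdist a b + mdist b c - mdist a c.
Proof. by rewrite subr_ge0; have [[_ _ _ tri] _] := hX. Qed.

Lemma lamp_dist_triangle w2 w1 w3 :
  lamp_dist w1 w3 <= lamp_dist w1 w2 + lamp_dist w2 w3.
Proof.
have [s [_ e]] := lamp_dist_excess w1 w2 w3.
rewrite -subr_ge0 e; apply: sumr_ge0 => y _; exact: mdist_excess_ge0.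
Qed.

(** The triangle excess is a finite sum of nonnegative pointwise excesses, so it vanishes iff each
    of them does. *)
Lemma lamp_dist_ivalP w1 w2 w3 :
  lamp_dist w1 w3 = lamp_dist w1 w2 + lamp_dist w2 w3 <->
  forall y, ival (@mdist R X) (wreath_map w1 y) (wreath_map w3 y) (wreath_map w2 y).
Proof.
have [s [out e]] := lamp_dist_excess w1 w2 w3; split=> [eq13 y|iv].
  have [ys|/out//] := boolP (y \in s).
  move: e; rewrite eq13 subrr => /esym/eqP.
  rewrite psumr_eq0; last by move=> z _; exact: mdist_excess_ge0.
  by move=> /allP/(_ _ ys) /=; rewrite subr_eq0 => /eqP.
apply/esym/eqP; rewrite -subr_eq0 e big1 // => y _.
by have := iv y; rewrite /ival /= => ->; rewrite subrr.
Qed.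

Lemma lamp_distxx w : lamp_dist w w = 0.
Proof.
have /lamp_dist_ivalP : forall y,
    ival (@mdist R X) (wreath_map w y) (wreath_map w y) (wreath_map w y).
  by move=> y; rewrite /ival /= mdistxx addr0.
lra.
Qed.

Lemma lamp_distC w1 w2 : lamp_dist w1 w2 = lamp_dist w2 w1.
Proof.
have [[_ _ dC _] _] := hX.
by congr (\big[_/_]_(y \in _) _); apply/funext => y; exact: dC.
Qed.

Lemma lamp_dist_ge0 w1 w2 : 0 <= lamp_dist w1 w2.
Proof.
have := lamp_dist_triangle w2 w1 w1; rewrite lamp_distxx (lamp_distC w2); lra.
Qed.

Lemma lamp_dist_eq0 w1 w2 : lamp_dist w1 w2 = 0 -> wreath_map w1 = wreath_map w2.
Proof.
move=> e; apply/funext => y.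
(* Distance zero puts [w2] between [w1] and itself, and pointwise that interval is a single
   point. *)
have /lamp_dist_ivalP/(_ y) : lamp_dist w1 w1 = lamp_dist w1 w2 + lamp_dist w2 w1.
  by rewrite lamp_distxx (lamp_distC w2) e addr0.
by move=> i; apply/esym/(ival_eq hX i).
Qed.

(** * Metric axioms and the median property of delta *)

Lemma diadem_dist_metric : is_metric (fun w1 w2 => diadem_dist mu w1 w2).
Proof.
split=> [w|w1 w2|w1 w2|w2 w1 w3]; rewrite !diadem_distE.
- by rewrite wall_distxx lamp_distxx addr0.
- have := wall_dist_ge0 w1 w2; have := lamp_dist_ge0 w1 w2 => l0 d0 e.
  by apply: wreath_eq; [apply: wall_dist_eq0|apply: lamp_dist_eq0]; lra.
- by rewrite wall_distC lamp_distC.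
- have := wall_dist_triangle w2 w1 w3; have := lamp_dist_triangle w2 w1 w3; lra.
Qed.

(** Both summands of delta satisfy the triangle inequality, so equality for the sum means equality
    for each. *)
Lemma diadem_ivalP w1 w2 m :
  ival (fun w1 w2 => diadem_dist mu w1 w2) w1 w2 m <->
  wall_dist w1 w2 = wall_dist w1 m + wall_dist m w2 /\
  forall y, ival (@mdist R X) (wreath_map w1 y) (wreath_map w2 y) (wreath_map m y).
Proof.
rewrite -lamp_dist_ivalP /ival /= !diadem_distE.
have := wall_dist_triangle m w1 w2; have := lamp_dist_triangle m w1 w2.
move=> ? ?; split=> [?|[? ?]]; [split|]; lra.
Qed.

Lemma diadem_dist_median : is_median (fun w1 w2 => diadem_dist mu w1 w2).
Proof.
move=> w1 w2 w3; have [m hm] := wreath_median_exists hX w1 w2 w3 hY.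
have hm2 := wreath_median_rot hX hm.
have hm132 := wreath_median_swap hX (wreath_median_rot hX hm2).
exists m; apply/seteqP; split=> m'; last first.
  move=> ->; split; [split|]; apply/diadem_ivalP; split.
  - exact: wall_dist_median hm.
  - by move=> y; case: (wreath_median_map hm y).
  - exact: wall_dist_median hm2.
  - by move=> y; case: (wreath_median_map hm y).
  - exact: wall_dist_median hm132.
  - by move=> y; case: (wreath_median_map hm y).
move=> [[/diadem_ivalP[e12 i12] /diadem_ivalP[e23 i23]] /diadem_ivalP[e13 i13]].
(* Uniqueness: the sets agree since their wall distance is zero, the maps since medians in [X] are
   unique. *)
apply: wreath_eq.
  exact/esym/wall_dist_eq0/(wall_dist_median_uniq hm).
apply/funext => y.
have [p ep] := hX.2 (wreath_map w1 y) (wreath_map w2 y) (wreath_map w3 y).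
have -> : wreath_map m' y = p.
  by suff : [set p] (wreath_map m' y) by []; rewrite -ep; split; [split|].
suff : [set p] (wreath_map m y) by [].
by rewrite -ep; have [? ? ?] := wreath_median_map hm y; split; [split|].
Qed.

End Diadem.

Theorem theorem3p20 (R : realType) (X Y : metricType R)
    (hX : median_space (@mdist R X)) (hY : median_space (@mdist R Y))
    (x0 : X)
    (G : set (set (set (set Y))))
    (mu : {measure set (g_sigma_algebraType G) -> \bar R})
    (hmu : hyperplane_measure mu) :
  median_space (fun w1 w2 : diadem X Y x0 => diadem_dist mu w1 w2).
Proof.
split; first exact: (diadem_dist_metric hX hY hmu).
exact: (diadem_dist_median hX hY hmu).
Qed.
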